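(* Let $V$ be Thompson's group $V$. There exists an element $\sigma \in V$ such that $\langle (00 \ 01), \sigma \rangle = \langle (10 \ 11), \sigma \rangle = V$.
   Context: Let $\mathfrak{C} = \{0,1\}^{\omega}$ be Cantor space. For $u \in \{0,1\}^*$ let $u\mathfrak{C} = \{uw \mid w \in \mathfrak{C}\}$. A finite set $A \subseteq \{0,1\}^*$ is a basis of $\mathfrak{C}$ if $\{u\mathfrak{C} \mid u \in A\}$ is a partition of $\mathfrak{C}$. Thompson's group $V$ is the group of homeomorphisms $\gamma$ of $\mathfrak{C}$ (acting on the right) for which there exists a bijection $g\colon A \to B$ between two bases $A$ and $B$ of $\mathfrak{C}$ such that $(uw)\gamma = (ug)w$ for all $u \in A$ and $w \in \mathfrak{C}$. For $u, v \in \{0,1\}^*$ with $u\mathfrak{C} \cap v\mathfrak{C} = \emptyset$, $(u \ v)$ denotes the element of $V$ that maps $uw \mapsto vw$ and $vw \mapsto uw$ for all $w \in \mathfrak{C}$ and fixes every other point of $\mathfrak{C}$. *)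

(* Defs.v *)
From HB Require Import structures.
From mathcomp Require Import all_boot.
From mathcomp Require Import all_classical.
From mathcomp Require Import topology cantor.

Set Implicit Arguments.
Unset Strict Implicit.
Unset Printing Implicit Defensive.

Local Open Scope classical_set_scope.
Local Open Scope group_scope.

Record homeo (T : topologicalType) := Homeo {
  homeo_fun :> T -> T;
  homeo_inv : T -> T;
  homeo_funK : cancel homeo_fun homeo_inv;
  homeo_invK : cancel homeo_inv homeo_fun;
  homeo_continuous : continuous homeo_fun;
  homeo_inv_continuous : continuous homeo_inv }.

Lemma homeoP (T : topologicalType) (f g : homeo T) : f =1 g -> f = g.
Proof.
case: f g => [f f' fK f'K cf cf'] [g g' gK g'K cg cg'] /= fg.
have {}fg : f = g by apply: funext.
have fg' : f' = g' by apply: funext => x; rewrite -{1}(g'K x) -fg fK.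
by subst g g'; congr Homeo; exact: Prop_irrelevance.
Qed.

HB.instance Definition _ (T : topologicalType) := gen_eqMixin (homeo T).
HB.instance Definition _ (T : topologicalType) := gen_choiceMixin (homeo T).

Section homeo_group.
Context {T : topologicalType}.
Implicit Types f g : homeo T.

Lemma continuous_id_fun : continuous (@idfun T).
Proof. by move=> x; exact: cvg_id. Qed.

Lemma continuous_comp_fun (f g : T -> T) :
  continuous f -> continuous g -> continuous (g \o f).
Proof. by move=> cf cg x; apply: continuous_comp; [exact: cf | exact: cg]. Qed.

Definition homeo1 : homeo T :=
  @Homeo T idfun idfun (fun=> erefl) (fun=> erefl)
    continuous_id_fun continuous_id_fun.

Definition homeoV f : homeo T :=
  Homeo (@homeo_invK T f) (@homeo_funK T f)
    (@homeo_inv_continuous T f) (@homeo_continuous T f).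

(* Homeomorphisms act on the right: in [f * g], [f] is applied first. *)
Definition homeoM f g : homeo T :=
  @Homeo T (g \o f) (homeo_inv f \o homeo_inv g)
    (can_comp (@homeo_funK T g) (@homeo_funK T f))
    (can_comp (@homeo_invK T f) (@homeo_invK T g))
    (continuous_comp_fun (@homeo_continuous T f) (@homeo_continuous T g))
    (continuous_comp_fun (@homeo_inv_continuous T g)
      (@homeo_inv_continuous T f)).

Lemma homeoMA : associative homeoM. Proof. by move=> f g h; exact: homeoP. Qed.
Lemma homeo1M : left_id homeo1 homeoM. Proof. by move=> f; exact: homeoP. Qed.
Lemma homeoM1 : right_id homeo1 homeoM. Proof. by move=> f; exact: homeoP. Qed.
Lemma homeoVM : left_inverse homeo1 homeoV homeoM.
Proof. by move=> f; apply: homeoP => x; exact: homeo_invK. Qed.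
Lemma homeoMV : right_inverse homeo1 homeoV homeoM.
Proof. by move=> f; apply: homeoP => x; exact: homeo_funK. Qed.

HB.instance Definition _ :=
  isGroup.Build (homeo T) homeoMA homeo1M homeoM1 homeoVM homeoMV.
End homeo_group.

Definition is_subgroup (G : groupType) (H : set G) : Prop :=
  group_closed (mem H).

Definition subgroup_gen (G : groupType) (S : set G) : set G :=
  smallest (@is_subgroup G) S.

(* Digits 0 and 1 are [false] and [true]; [prepend u w] is the sequence uw. *)
Definition prepend (u : seq bool) (w : cantor_space) : cantor_space :=
  fun n => if n < size u then nth false u n else w (n - size u).

Definition shift (k : nat) (x : cantor_space) : cantor_space :=
  fun n => x (k + n).

Definition cone (u : seq bool) : set cantor_space := range (prepend u).

Definition is_basis (A : set (seq bool)) : Prop :=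
  finite_set A /\ partition A cone [set: cantor_space].

Definition thompsonV : set (homeo cantor_space) :=
  [set gamma | exists A B : set (seq bool), exists g : seq bool -> seq bool,
    [/\ is_basis A, is_basis B, set_bij A B g &
        forall u w, A u -> gamma (prepend u w) = prepend (g u) w]].

Definition swap_fun (u v : seq bool) (x : cantor_space) : cantor_space :=
  if x \in cone u then prepend v (shift (size u) x)
  else if x \in cone v then prepend u (shift (size v) x)
  else x.

Lemma shift_prepend u w : shift (size u) (prepend u w) = w.
Proof.
by apply: funext => n; rewrite /shift /prepend ltnNge leq_addr /= addKn.
Qed.

Lemma coneP u x : cone u x <-> forall i, i < size u -> x i = nth false u i.
Proof.
split=> [[w _ <-] i iu | xu]; first by rewrite /prepend iu.
exists (shift (size u) x) => //; apply: funext => n; rewrite /prepend /shift.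
by case: ltnP => [/xu//|un]; rewrite subnKC.
Qed.

Lemma swap_funl u v w : swap_fun u v (prepend u w) = prepend v w.
Proof.
by rewrite /swap_fun mem_set ?shift_prepend //; exists w.
Qed.

Lemma swap_funr u v w : cone u `&` cone v = set0 ->
  swap_fun u v (prepend v w) = prepend u w.
Proof.
move=> uv; have vw : cone v (prepend v w) by exists w.
rewrite /swap_fun memNset ?mem_set ?shift_prepend // => uw.
by have : (cone u `&` cone v) (prepend v w) by []; rewrite uv.
Qed.

Lemma swap_fun_id u v x : ~ cone u x -> ~ cone v x -> swap_fun u v x = x.
Proof. by move=> ux vx; rewrite /swap_fun !memNset. Qed.

Lemma swap_funK u v : cone u `&` cone v = set0 ->
  cancel (swap_fun u v) (swap_fun u v).
Proof.
move=> uv x; have [[w _ <-]|ux] := pselect (cone u x).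
  by rewrite swap_funl swap_funr.
have [[w _ <-]|vx] := pselect (cone v x); first by rewrite swap_funr ?swap_funl.
by rewrite !swap_fun_id.
Qed.

Lemma cantor_nbhs_agree (x : cantor_space) N :
  nbhs x [set y | forall i, i < N -> y i = x i].
Proof.
elim: N => [|N IH]; first by apply: filterS filterT => y _ i.
have HN : nbhs x [set y : cantor_space | y N = x N].
  have c : {for x, continuous (fun y : cantor_space => y N : bool)}.
    exact: (@proj_continuous nat (fun=> bool) N x).
  exact: (c [set b | b = x N] (discrete_set1 (x N))).
apply: filterS2 IH HN => y /= yx yN i.
by rewrite ltnS leq_eqVlt => /predU1P[->//|/yx].
Qed.

Lemma cantor_continuous (f : cantor_space -> cantor_space) :
  (forall x n, exists N, forall y, (forall i, i < N -> y i = x i) ->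
     f y n = f x n) -> continuous f.
Proof.
move=> fP x; apply/cvg_sup => n U [V] [[W] oW <-] Wfx WU.
have [N fN] := fP x n.
apply: filterS (cantor_nbhs_agree x N) => y /fN fyx.
by apply: WU; rewrite /= fyx.
Qed.

Lemma swap_fun_continuous u v : continuous (swap_fun u v).
Proof.
apply: cantor_continuous => x n; exists (size u + size v + n).+1 => y yx.
have coneE t : size t <= size u + size v -> (y \in cone t) = (x \in cone t).
  move=> tuv; apply/asboolP/asboolP => /coneP h; apply/coneP => i it;
    by rewrite -(h i it) yx // ltnS (leq_trans (ltnW it)) ?(leq_trans tuv)
               ?leq_addr.
rewrite /swap_fun !coneE ?leq_addr ?leq_addl //.
case: ifP => _; [|case: ifP => _]; rewrite /prepend /shift.
- case: ifP => // _; apply: yx.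
  by rewrite ltnS leq_add ?leq_addr ?leq_subr.
- case: ifP => // _; apply: yx.
  by rewrite ltnS leq_add ?leq_addl ?leq_subr.
- by apply: yx; rewrite ltnS leq_addl.
Qed.

Definition swap (u v : seq bool) (uv : cone u `&` cone v = set0) :
    homeo cantor_space :=
  Homeo (swap_funK uv) (swap_funK uv)
    (@swap_fun_continuous u v) (@swap_fun_continuous u v).

Arguments swap u v uv : clear implicits.

Lemma cone_disjoint u v i : i < size u -> i < size v ->
  nth false u i != nth false v i -> cone u `&` cone v = set0.
Proof.
move=> iu iv /eqP uvi; rewrite -subset0 => x [/coneP/(_ _ iu) xu].
by move=> /coneP/(_ _ iv) xv; apply: uvi; rewrite -xu -xv.
Qed.

Lemma disjoint_00_01 : cone [:: false; false] `&` cone [:: false; true] = set0.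
Proof. exact: (@cone_disjoint _ _ 1). Qed.

Lemma disjoint_10_11 : cone [:: true; false] `&` cone [:: true; true] = set0.
Proof. exact: (@cone_disjoint _ _ 1). Qed.

(* Main.v *)
(* Let sigma be the cycle (a_0 a_1 ... a_9) on the basis
     000, 010, 1111, 001, 1110, 0110, 101, 0111, 110, 100.
   The flip (0 1) maps a_n to a_(9-n): it inverts sigma and exchanges (00 01)
   with (10 11), so it suffices that t = (00 01) and sigma generate V.
   Here t = (a_0 a_1) (001 011), and a_3 = 001 and the children a_5, a_7 of 011
   are placed so that t and t^sigma multiply to a 3-cycle times two commuting
   swaps of disjoint support; the square is a 3-cycle of consecutive leaves.
   Since sigma is an odd permutation, sigma and this 3-cycle generate all the
   permutations of the leaves. Hence (a_0 a_1), and then (001 011), are in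
   <t, sigma>; the latter does not permute any refinement of the basis that
   sigma permutes, and conjugation by it yields swaps of arbitrarily long
   words. *)
Require Import Defs.
From mathcomp Require Import all_boot.
From mathcomp Require Import all_classical.
From mathcomp Require Import topology cantor.

Set Implicit Arguments.
Unset Strict Implicit.
Unset Printing Implicit Defensive.

Local Open Scope classical_set_scope.
Local Open Scope group_scope.

Implicit Types (u v w p q s : seq bool) (x : cantor_space).
Implicit Types (f g gamma : homeo cantor_space).

(** * Words, cones and incomparability *)

Lemma homeoME f g x : (f * g) x = g (f x).
Proof. by []. Qed.

Lemma homeoVK f : cancel f (f^-1)%g.
Proof. exact: homeo_funK. Qed.

Lemma homeoKV f : cancel (f^-1)%g f.
Proof. exact: homeo_invK. Qed.

Lemma prepend_cat u v x : prepend (u ++ v) x = prepend u (prepend v x).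
Proof.
apply: funext => n; rewrite /prepend size_cat nth_cat.
case: ltnP => [nuv|uvn].
  case: ltnP => [//|un]; by rewrite ltn_subLR ?nuv.
rewrite ltnNge (leq_trans (leq_addr _ _) uvn) /=.
by rewrite ltnNge leq_subRL ?uvn ?subnDA //= (leq_trans (leq_addr _ _) uvn).
Qed.

Lemma prepend0 x : prepend [::] x = x.
Proof. by apply: funext => n; rewrite /prepend /= subn0. Qed.

Lemma cone_prepend u x : cone u (prepend u x).
Proof. by exists x. Qed.

Lemma sub_cone u v : prefix u v -> cone v `<=` cone u.
Proof.
by move=> /prefixP[s ->] _ [x _ <-]; rewrite prepend_cat; exact: cone_prepend.
Qed.

Lemma cone_prefix u v x :
  size u <= size v -> cone u x -> cone v x -> prefix u v.
Proof.
move=> uv /coneP ux /coneP vx; rewrite prefixE; apply/eqP.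
have su : size (take (size u) v) = size u by rewrite size_takel.
apply: (@eq_from_nth _ false) => // i; rewrite su => iu.
by rewrite nth_take // -ux // vx // (leq_trans iu).
Qed.

Definition incomparable u v := ~~ prefix u v && ~~ prefix v u.

Lemma incomparableC u v : incomparable u v = incomparable v u.
Proof. exact: andbC. Qed.

Lemma incomparablexx u : incomparable u u = false.
Proof. by rewrite /incomparable prefix_refl. Qed.

Lemma incomparable_siblings p b : incomparable (rcons p b) (rcons p (~~ b)).
Proof.
rewrite /incomparable !prefixE !size_rcons !take_oversize ?size_rcons //.
by rewrite !eqseq_rcons !eqxx /=; case: b.
Qed.

Lemma cone_comparable u v x : cone u x -> cone v x -> ~~ incomparable u v.
Proof.
move=> ux vx; rewrite negb_and !negbK.
by case/orP: (leq_total (size u) (size v)) => uv; apply/orP; [left|right];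
  apply: cone_prefix uv _ _; eassumption.
Qed.

Lemma incomparableP u v :
  reflect (cone u `&` cone v = set0) (incomparable u v).
Proof.
apply: (iffP idP) => [uv|uv].
  by rewrite -subset0 => x [ux /(cone_comparable ux)]; rewrite uv.
apply/andP; split; apply/negP => h; move: uv; apply/eqP/set0P.
  by exists (prepend v point); split; [apply: (sub_cone h)|]; exact: cone_prepend.
by exists (prepend u point); split; [|apply: (sub_cone h)]; exact: cone_prepend.
Qed.

(** * Prefix replacement and swaps of cones *)

Definition acts gamma u v := forall x, gamma (prepend u x) = prepend v x.

Lemma acts1 u : acts 1 u u.
Proof. by []. Qed.

Lemma actsM f g u v w : acts f u v -> acts g v w -> acts (f * g) u w.
Proof. by move=> fuv gvw x; rewrite homeoME fuv gvw. Qed.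

Lemma actsV f u v : acts f u v -> acts f^-1 v u.
Proof. by move=> fuv x; rewrite -fuv homeoVK. Qed.

Lemma acts_cat f u v s : acts f u v -> acts f (u ++ s) (v ++ s).
Proof. by move=> fuv x; rewrite !prepend_cat. Qed.

Lemma acts_prefix f u v p :
  acts f u v -> prefix u p -> acts f p (v ++ drop (size u) p).
Proof.
by move=> fuv /prefixP[s ->]; rewrite drop_size_cat //; exact: acts_cat.
Qed.

Lemma acts_incomparable f u v u' v' :
  acts f u u' -> acts f v v' -> incomparable u v -> incomparable u' v'.
Proof.
move=> fu fv /incomparableP uv; apply/incomparableP; rewrite -subset0.
move=> x [[y _ xy] [z _]]; rewrite -xy -fu -fv => /(congr1 (f^-1)%g).
rewrite !homeoVK => e; suff: set0 (prepend u y) by [].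
by rewrite -uv; split; [|rewrite -e]; exact: cone_prepend.
Qed.

(* The product (u v), completed by the identity when [u] and [v] are
   comparable. *)
Definition cswap u v : homeo cantor_space :=
  if pselect (cone u `&` cone v = set0) is left uv then swap u v uv else 1.

Lemma cswapE u v uv : cswap u v = swap u v uv.
Proof.
by rewrite /cswap; case: pselect => // h; congr swap; exact: Prop_irrelevance.
Qed.

Lemma cswap_id u v : ~~ incomparable u v -> cswap u v = 1.
Proof. by move=> /incomparableP uv; rewrite /cswap; case: pselect. Qed.

Lemma cswapl u v : incomparable u v -> acts (cswap u v) u v.
Proof. by move=> /incomparableP uv x; rewrite cswapE; exact: swap_funl. Qed.

Lemma cswapr u v : incomparable u v -> acts (cswap u v) v u.
Proof. by move=> /incomparableP uv x; rewrite cswapE; exact: swap_funr. Qed.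

Lemma cswap_fix u v x : ~ cone u x -> ~ cone v x -> cswap u v x = x.
Proof.
move=> ux vx; rewrite /cswap; case: pselect => // uv; exact: swap_fun_id.
Qed.

Lemma cswap_out u v p :
  incomparable u p -> incomparable v p -> acts (cswap u v) p p.
Proof.
move=> up vp x; apply: cswap_fix => h.
  by move: up; apply/negP/(cone_comparable h)/cone_prepend.
by move: vp; apply/negP/(cone_comparable h)/cone_prepend.
Qed.

Lemma cswapK u v : cswap u v * cswap u v = 1.
Proof.
rewrite /cswap; case: pselect => [uv|_]; last exact: mul1g.
by apply: homeoP => x; exact: swap_funK.
Qed.

Lemma cswapV u v : (cswap u v)^-1 = cswap u v.
Proof. by rewrite -[LHS]mulg1 -(cswapK u v) mulKg. Qed.

Lemma cswapC u v : cswap u v = cswap v u.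
Proof.
have [uv|uv] := boolP (incomparable u v); last first.
  by rewrite !cswap_id // incomparableC.
have vu : incomparable v u by rewrite incomparableC.
apply: homeoP => x.
have [[y _ <-]|ux] := pselect (cone u x); first by rewrite cswapl ?cswapr.
have [[y _ <-]|vx] := pselect (cone v x); first by rewrite cswapl ?cswapr.
by rewrite !cswap_fix.
Qed.

(** A point below [u'] goes back below [u], is swapped, and is carried on below [v']. A point
    outside both cones has its preimage outside the cones of [u] and [v], hence returns to
    itself. *)
Lemma cswapJ f u v u' v' : incomparable u v ->
  acts f u u' -> acts f v v' -> f^-1 * cswap u v * f = cswap u' v'.
Proof.
move=> uv fu fv; have uv' := acts_incomparable fu fv uv.
apply: homeoP => x; rewrite !homeoME.
have [[y _ <-]|ux] := pselect (cone u' x).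
  by rewrite (actsV fu) (cswapl uv) fv (cswapl uv').
have [[y _ <-]|vx] := pselect (cone v' x).
  by rewrite (actsV fv) (cswapr uv) fu (cswapr uv').
rewrite [RHS]cswap_fix // cswap_fix ?homeoKV // => -[y _ e].
- by apply: ux; rewrite -(homeoKV f x) -e fu; exact: cone_prepend.
- by apply: vx; rewrite -(homeoKV f x) -e fv; exact: cone_prepend.
Qed.

Lemma incomparable_child u v b c :
  incomparable u v -> incomparable (rcons u b) (rcons v c).
Proof.
move=> /incomparableP uv; apply/incomparableP; rewrite -subset0 -uv.
by apply: setISS; apply: sub_cone; exact: prefix_rcons.
Qed.

Lemma cone_child u x : cone u x -> exists b, cone (rcons u b) x.
Proof.
move=> /coneP ux; exists (x (size u)); apply/coneP => i.
rewrite size_rcons ltnS nth_rcons leq_eqVlt => /predU1P[->|iu].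
  by rewrite ltnn eqxx.
by rewrite iu ux.
Qed.

(** The two factors have disjoint supports. Read from right to left, this yields swaps of shorter
    words. *)
Lemma cswap_merge u v : incomparable u v ->
  cswap u v = cswap (rcons u false) (rcons v false) *
              cswap (rcons u true) (rcons v true).
Proof.
move=> uv; have uvc b c := incomparable_child b c uv.
have iu p := incomparable_siblings p false.
apply: homeoP => x; rewrite homeoME.
have ca b f p q (h : acts f p q) := @acts_cat f p q [:: b] h.
have catE p b : p ++ [:: b] = rcons p b by rewrite cats1.
have vuc b c : incomparable (rcons v b) (rcons u c) by rewrite incomparableC.
have iu' p := incomparable_siblings p true.
have [/cone_child[b [y _ <-]]|ux] := pselect (cone u x).
  rewrite -catE (ca b _ _ _ (cswapl uv)) !catE.
  case: b; first by rewrite [X in cswap _ _ X]cswap_out ?cswapl.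
  by rewrite cswapl // cswap_out.
have [/cone_child[b [y _ <-]]|vx] := pselect (cone v x).
  rewrite -catE (ca b _ _ _ (cswapr uv)) !catE.
  case: b; first by rewrite [X in cswap _ _ X]cswap_out ?cswapr.
  by rewrite cswapr // cswap_out.
have nc p b : ~ cone p x -> ~ cone (rcons p b) x.
  by apply: contra_not => ?; apply: sub_cone (prefix_rcons p b) _ _.
by rewrite cswap_fix // !cswap_fix //; exact: nc.
Qed.

Lemma prefix_rconsP v p b : prefix v (rcons p b) -> v = rcons p b \/ prefix v p.
Proof.
case/prefixP => s; case/lastP: s => [|s c]; first by rewrite cats0; left.
by rewrite -rcons_cat => /rcons_inj[-> _]; right; exact: prefix_prefix.
Qed.

(** * Closure properties of subgroups *)

Section Subgroup.
Variables (G : groupType) (H : set G).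
Hypothesis sgH : is_subgroup H.

Lemma subgroup1 : H 1.
Proof. by have [/set_mem] := sgH. Qed.

Lemma subgroupM (a b : G) : H a -> H b -> H (a * b).
Proof.
by move=> Ha Hb; apply/set_mem/(group_closedM sgH); exact: mem_set.
Qed.

Lemma subgroupV (a : G) : H a -> H a^-1.
Proof. by move=> Ha; apply/set_mem/(group_closedV sgH); exact: mem_set. Qed.

Lemma subgroupMr (a b : G) : H b -> H (a * b) -> H a.
Proof. by move=> Hb Hab; rewrite -(mulgK b a); apply/subgroupM/subgroupV. Qed.

End Subgroup.

(** * Bases as lists of words; generation by all swaps *)

Definition word_basis (D : seq (seq bool)) :=
  [/\ uniq D, {in D &, forall u v, u != v -> incomparable u v} &
      forall x, exists2 u, u \in D & cone u x].

Lemma word_basis_uniq D u v :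
  word_basis D -> u \in D -> v \in D -> prefix u v -> u = v.
Proof.
case=> _ dD _ uD vD uv; apply/eqP/contraT => /(dD _ _ uD vD).
by rewrite /incomparable uv.
Qed.

Lemma deepest_word (D : seq (seq bool)) u0 : u0 \in D ->
  exists2 u, u \in D & {in D, forall v, size v <= size u}.
Proof.
elim: D u0 => // a D IH u0 _; case: D IH => [_|b D /(_ b (mem_head _ _))].
  by exists a => [|v]; rewrite inE // => /eqP->.
move=> [u uD max_u]; have [au|ua] := leqP (size a) (size u).
  exists u => [|v]; first by rewrite in_cons uD orbT.
  by rewrite in_cons => /predU1P[->|/max_u].
exists a => [|v]; first exact: mem_head.
by rewrite in_cons => /predU1P[->//|/max_u/leq_trans->//]; exact: ltnW.
Qed.

(* The sibling of a deepest word of a basis is in the basis. *)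
Lemma word_basis_cherry D : word_basis D ->
  D = [:: [::]] \/ exists p, forall b, rcons p b \in D.
Proof.
move=> bD; have [uD dD cD] := bD; have [u0 u0D _] := cD point.
have [u] := deepest_word u0D; case/lastP: u => [nilD max0|p b pD max_p].
  left; have all0 v : v \in D -> v = [::].
    by move=> /max0; rewrite leqn0 size_eq0 => /eqP.
  case: D uD nilD all0 {bD u0 u0D dD cD max0} => [//|a [|b D]] uD _ all0.
    by rewrite (all0 a (mem_head _ _)).
  move: uD; rewrite (all0 a (mem_head _ _)) (all0 b) ?inE ?eqxx //.
  by rewrite orbT.
right; exists p => c; have [->//|cb] := eqVneq c b.
have {cb}-> : c = ~~ b by case: (c) (b) cb => [] [].
have [v vD vx] := cD (prepend (rcons p (~~ b)) point).
have : prefix v (rcons p (~~ b)).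
  apply: cone_prefix vx (cone_prepend _ _).
  by rewrite (leq_trans (max_p v vD)) ?size_rcons.
case/prefix_rconsP => [<-//|vp].
have := word_basis_uniq bD vD pD (prefix_trans vp (prefix_rcons p b)).
by move=> e; move: vp => /size_prefix; rewrite e size_rcons ltnn.
Qed.

(** The bijection [gamma] transports disjointness, and a point is covered by the image of the word
    that covers its preimage. *)
Lemma word_basis_image D (h : seq bool -> seq bool) gamma : word_basis D ->
  {in D, forall u, acts gamma u (h u)} -> word_basis (map h D).
Proof.
move=> [uD dD cD] gh.
have dh : {in D &, forall u v, u != v -> incomparable (h u) (h v)}.
  move=> u v uD' vD uv.
  by apply: acts_incomparable (gh u _) (gh v _) (dD _ _ _ _ uv).
split.
- rewrite map_inj_in_uniq // => u v uD' vD e; apply/eqP/contraT => /(dh _ _ uD' vD).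
  by rewrite e incomparablexx.
- move=> _ _ /mapP[u uD' ->] /mapP[v vD ->] uv; apply: dh => //.
  by apply: contra uv => /eqP->.
- move=> x; have [u uD' [y _ yx]] := cD ((gamma^-1)%g x).
  exists (h u); first exact: map_f.
  by rewrite -(homeoKV gamma x) -yx gh //; exact: cone_prepend.
Qed.

Definition transpose u v w := if w == u then v else if w == v then u else w.

Lemma acts_cswap B u v w : word_basis B -> u \in B -> v \in B -> w \in B ->
  acts (cswap u v) w (transpose u v w).
Proof.
move=> [_ dB _] uB vB wB; rewrite /transpose.
have [->|uv] := eqVneq u v.
  by rewrite cswap_id ?incomparablexx //; case: eqP => [->|_]; exact: acts1.
case: eqVneq => [->|wu]; first exact/cswapl/dB.
case: eqVneq => [->|wv]; first exact/cswapr/dB.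
by apply: cswap_out; apply: dB => //; rewrite eq_sym.
Qed.

Lemma transpose_mem (B : seq (seq bool)) u v w :
  u \in B -> v \in B -> w \in B -> transpose u v w \in B.
Proof. by rewrite /transpose => uB vB wB; case: ifP => // _; case: ifP. Qed.

Lemma word_basis_merge D p : word_basis D -> (forall b, rcons p b \in D) ->
  word_basis (p :: rem (rcons p true) (rem (rcons p false) D)).
Proof.
move=> bD pD; have [uD dD cD] := bD.
set D' := rem _ _.
have memD' u : (u \in D') = [&& u != rcons p true, u != rcons p false & u \in D].
  by rewrite (mem_rem_uniq _ (rem_uniq _ uD)) inE /= (mem_rem_uniq _ uD) inE.
(* A word extending [p] would meet the cone of a removed sibling, and a prefix of [p] would be a
   proper prefix of a word of the basis. *)
have pu u : u \in D' -> incomparable p u.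
  rewrite memD' => /and3P[u1 u0 uD'].
  apply: contraT; rewrite negb_and !negbK => /orP[pu|up].
    have [b] : exists b, cone (rcons p b) (prepend u point).
      by apply: cone_child; apply: sub_cone pu _ _; exact: cone_prepend.
    move=> /cone_comparable /(_ (cone_prepend u point))/negP[].
    by apply: dD => //; rewrite eq_sym; case: b.
  have := word_basis_uniq bD uD' (pD true) (prefix_trans up (prefix_rcons p true)).
  by move/eqP; rewrite (negPf u1).
split.
- rewrite /= rem_uniq ?rem_uniq // andbT; apply/negP => /pu.
  by rewrite incomparablexx.
- move=> u v; rewrite !in_cons => /predU1P[->|uD'] /predU1P[->|vD'].
  + by rewrite eqxx.
  + by rewrite pu.
  + by rewrite incomparableC pu.
  + by apply: dD; [move: uD'|move: vD']; rewrite memD' => /and3P[].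
- move=> x; have [u uD' ux] := cD x.
  have [up|up] := boolP (prefix p u).
    by exists p; [exact: mem_head|exact: sub_cone up _ ux].
  exists u => //; rewrite in_cons memD' uD' andbT.
  by apply/orP; right; apply/andP; split; apply: contra up => /eqP->;
    exact: prefix_rcons.
Qed.

Lemma acts_merge gamma u v :
  (forall b, acts gamma (rcons u b) (rcons v b)) -> acts gamma u v.
Proof.
move=> guv x; have [b [y _]] := cone_child (cone_prepend u x).
rewrite -cats1 prepend_cat => /(congr1 (shift (size u))); rewrite !shift_prepend.
by move=> <-; rewrite -!prepend_cat !cats1; exact: guv.
Qed.

(* Induction on the number of words of the domain basis: after two swaps, a
   pair of siblings of the domain is mapped onto a pair of siblings of the
   range, in order, and both pairs can be merged. *)
Lemma cswaps_generate (H : set (homeo cantor_space)) D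
    (h : seq bool -> seq bool) gamma :
  is_subgroup H -> (forall u v, H (cswap u v)) -> word_basis D ->
  {in D, forall u, acts gamma u (h u)} -> H gamma.
Proof.
move=> sgH Hsw; have [n] := ubnP (size D); elim: n D h gamma => // n IH D h gamma.
rewrite ltnS => szD bD gh.
have bB := word_basis_image bD gh; set B := map h D in bB.
have [|[a aD]] := word_basis_cherry bD.
  have [D1|[b bBb]] := word_basis_cherry bB => [eD|eD]; last first.
    have := bBb true; have := bBb false; rewrite /B eD /= !inE => /eqP<-.
    by rewrite eqseq_rcons andbF.
  have /(_ _ (mem_head _ _)) : {in [:: [::]], forall u, acts gamma u (h u)}.
    by rewrite -eD.
  have -> : h [::] = [::] by move: D1; rewrite /B eD => -[].
  move=> g1; suff -> : gamma = 1 by exact: subgroup1.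
  by apply: homeoP => x; have := g1 x; rewrite !prepend0.
have [B1|[b bBb]] := word_basis_cherry bB.
  have sD : size D = 1%N by rewrite -(size_map h) -/B B1.
  case: (D) sD aD => [|d [|//]] // _ aD.
  have := aD true; have := aD false; rewrite !inE => /eqP<-.
  by rewrite eqseq_rcons andbF.
have hB u : u \in D -> h u \in B by exact: map_f.
set f0 := cswap (h (rcons a false)) (rcons b false).
set h0 := transpose (h (rcons a false)) (rcons b false) \o h.
have gh0 : {in D, forall u, acts (gamma * f0) u (h0 u)}.
  by move=> u uD; apply: actsM (gh _ uD) _; apply: (acts_cswap bB) => //; exact: hB.
have h0B u : u \in D -> h0 u \in B.
  by move=> uD; apply: transpose_mem => //; exact: hB.
set f1 := cswap (h0 (rcons a true)) (rcons b true).
set h1 := transpose (h0 (rcons a true)) (rcons b true) \o h0.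
have gh1 : {in D, forall u, acts (gamma * f0 * f1) u (h1 u)}.
  move=> u uD; apply: actsM (gh0 _ uD) _.
  by apply: (acts_cswap bB) => //; exact: h0B.
have h0a : h0 (rcons a false) = rcons b false by rewrite /h0 /transpose /= eqxx.
have h1a c : h1 (rcons a c) = rcons b c.
  case: c; rewrite /h1 /transpose /= ?eqxx // h0a.
  (* The second swap must leave [rcons b false] in place: this word is already the image of
     [rcons a false], so it is not that of [rcons a true]. *)
  have -> : (rcons b false == h0 (rcons a true)) = false.
    apply/negbTE/negP => /eqP e.
    have := acts_incomparable (gh0 _ (aD false)) (gh0 _ (aD true))
      (incomparable_siblings a false).
    by rewrite h0a e incomparablexx.
  by rewrite eqseq_rcons andbF.
suff : H (gamma * f0 * f1).
  move=> Hg; apply: (subgroupMr sgH (Hsw _ _)).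
  exact: (subgroupMr sgH (Hsw _ _) Hg).
apply: (IH (a :: rem (rcons a true) (rem (rcons a false) D))
          (fun u => if u == a then b else h1 u)).
- have ra : rcons a true \in rem (rcons a false) D.
    have [uD _ _] := bD; rewrite mem_rem_uniq // !inE aD andbT.
    by rewrite eqseq_rcons andbF.
  rewrite /= (size_rem ra) (size_rem (aD false)).
  (* [D] holds two distinct siblings, so the truncated predecessors are exact and the size drops by
     one. *)
  move: szD (aD true) (aD false) ra; case: (D) => [//|d [|d' D']] //=.
  by rewrite !inE => _ /eqP<-; rewrite eqseq_rcons andbF.
- exact: word_basis_merge.
- move=> u; rewrite in_cons => /predU1P[->|uD'].
    by rewrite eqxx; apply: acts_merge => c; rewrite -h1a; exact: gh1.
  have [/= + _ _] := word_basis_merge bD aD.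
  case: eqVneq uD' => [->->//|_ uD' _]; apply: gh1.
  exact: mem_rem (mem_rem uD').
Qed.

(** * Membership in V, and V as a subgroup *)

Lemma is_basis_words (A : set (seq bool)) : is_basis A ->
  exists2 D : seq (seq bool), word_basis D & A = [set` D].
Proof.
move=> [/finite_seqP[s ->] [cA dA _]]; exists (undup s); last first.
  by apply/seteqP; split => u /=; rewrite mem_undup.
split; first exact: undup_uniq.
- move=> u v; rewrite !mem_undup => us vs; apply: contraR => uv.
  apply/eqP/dA => //; apply/set0P; apply: contra uv => /eqP uv.
  exact/incomparableP.
- move=> x; have : [set: cantor_space] x by []. 
  by rewrite -cA => -[u us ux]; exists u => //; rewrite mem_undup.
Qed.

Lemma word_basis_is_basis D : word_basis D -> is_basis [set` D].
Proof.
move=> [uD dD cD]; split; first exact: finite_seq.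
split.
- apply/seteqP; split => // x _; have [u uD' ux] := cD x; by exists u.
- move=> u v uD' vD' [x [ux vx]]; apply/eqP/contraT => /(dD _ _ uD' vD').
  by rewrite (negPf (cone_comparable ux vx)).
- by move=> u _; exists (prepend u point); exact: cone_prepend.
Qed.

(** Domain data suffice: the range basis is the image of [D], and [h] is injective on [D] because
    [gamma] is injective. *)
Lemma thompsonVP gamma : thompsonV gamma <->
  exists D h, word_basis D /\ {in D, forall u, acts gamma u (h u)}.
Proof.
split=> [[A [B [h [/is_basis_words[D bD ->] _ _ gh]]]]|[D [h [bD gh]]]].
  by exists D, h; split=> // u uD x; exact: gh.
exists [set` D], [set` map h D], h; split.
- exact: word_basis_is_basis.
- exact/word_basis_is_basis/(word_basis_image bD gh).
- have [_ dD _] := bD; split.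
  + by move=> u /= uD; exact: map_f.
  + move=> u v /set_mem uD /set_mem vD e; apply/eqP/contraT => /(dD _ _ uD vD).
    move=> /(acts_incomparable (gh _ uD) (gh _ vD)).
    by rewrite e incomparablexx.
  + by move=> _ /mapP[u uD ->]; exists u.
- by move=> u x uD; exact: gh.
Qed.

Fixpoint words n : seq (seq bool) :=
  if n is n'.+1 then [seq b :: u | b <- [:: false; true], u <- words n']
  else [:: [::]].

Lemma mem_words n u : (u \in words n) = (size u == n).
Proof.
elim: n u => [|n IH] u; first by rewrite inE size_eq0.
apply/allpairsP/eqP => [[[b v] /= [_ + ->]]|].
  by rewrite IH => /eqP /= ->.
case: u => // b u [su]; exists (b, u); rewrite IH su eqxx.
by split => //; case: b.
Qed.

Lemma cone_take n x : exists2 u, size u = n & cone u x.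
Proof.
exists (mkseq x n); first exact: size_mkseq.
by apply/coneP => i; rewrite size_mkseq => iN; rewrite nth_mkseq.
Qed.

Lemma word_basis_words n : word_basis (undup (words n)).
Proof.
split; first exact: undup_uniq.
- move=> u v; rewrite !mem_undup !mem_words => /eqP su /eqP sv uv.
  by rewrite /incomparable !prefixE su sv !take_oversize ?su ?sv //
    (eq_sym v) uv.
- move=> x; have [u su ux] := cone_take n x.
  by exists u => //; rewrite mem_undup mem_words su.
Qed.

(** Every basis is refined by the words of its maximal length. With a uniform depth, products need
    no common refinement of two bases. *)
Lemma thompsonV_acts gamma : thompsonV gamma <->
  exists n, forall u, size u = n -> exists v, acts gamma u v.
Proof.
split=> [/thompsonVP[D [h [[_ _ cD] gh]]]|[n gn]]; last first.
  have /choice[h hP] u : exists v, size u = n -> acts gamma u v.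
    have [/gn[v uv]|su] := pselect (size u = n); first by exists v.
    by exists u => /su.
  apply/thompsonVP; exists (undup (words n)), h; split.
    exact: word_basis_words.
  by move=> u; rewrite mem_undup mem_words => /eqP; exact: hP.
exists (\max_(d <- D) size d) => u su.
have [d dD du] := cD (prepend u point).
have /prefixP[s us] : prefix d u.
  apply: cone_prefix du (cone_prepend _ _).
  by rewrite su; apply: leq_bigmax_seq.
by exists (h d ++ s); rewrite us; apply: acts_cat; exact: gh.
Qed.

(** Only the first [n] digits are replaced, so a word loses at most [n] digits. *)
Lemma acts_long gamma n : (forall u, size u = n -> exists v, acts gamma u v) ->
  forall u, n <= size u -> exists2 v, acts gamma u v & size u <= n + size v.
Proof.
move=> gn u nu; have [v uv] := gn _ (size_takel nu).
exists (v ++ drop n u); first by rewrite -{1}(cat_take_drop n u); exact: acts_cat.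
by rewrite size_cat size_drop addnCA subnKC ?leq_addl.
Qed.

Lemma thompsonV_inv gamma : thompsonV gamma -> thompsonV gamma^-1.
Proof.
move=> /thompsonVP[D [h [bD gh]]]; apply/thompsonVP.
exists (map h D), (fun v => nth [::] D (index v (map h D))); split.
  exact: word_basis_image bD gh.
move=> v vD; have iD : index v (map h D) < size D.
  by rewrite -(size_map h) index_mem.
rewrite -{1}(nth_index [::] vD) (nth_map [::]) //.
by apply/actsV/gh; exact: mem_nth.
Qed.

Lemma thompsonV_subgroup : is_subgroup thompsonV.
Proof.
split.
  by apply/mem_set/thompsonV_acts; exists 0 => u _; exists u; exact: acts1.
move=> f g /set_mem/thompsonV_acts[m fm] /set_mem/thompsonV_inv/thompsonV_acts[n gn].
apply/mem_set/thompsonV_acts.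
(* A word of length [m + n] keeps at least [n] digits under [f], enough for the inverse of [g] to
   act on it. *)
exists (m + n) => u su; have [|v fuv] := acts_long fm (u := u).
  by rewrite su leq_addr.
rewrite su leq_add2l => nv; have [w gvw _] := acts_long gn nv.
by exists w; exact: actsM fuv gvw.
Qed.

Lemma thompsonV_cswap u v : thompsonV (cswap u v).
Proof.
have [uv|uv] := boolP (incomparable u v); last first.
  by rewrite cswap_id //; exact: subgroup1 thompsonV_subgroup.
(* A word of this length is no shorter than [u] or [v]: it extends one of them or is incomparable
   with both. *)
apply/thompsonV_acts; exists (size u + size v) => p sp.
have [[s ->]|up] := pselect (exists s, p = u ++ s).
  by exists (v ++ s); apply/acts_cat/cswapl.
have [[s ->]|vp] := pselect (exists s, p = v ++ s).
  by exists (u ++ s); apply/acts_cat/cswapr.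
have long q : size q <= size p -> ~ (exists s, p = q ++ s) -> incomparable q p.
  move=> qp nq; apply/andP; split; first by apply/negP => /prefixP.
  apply/negP => pq; apply: nq; exists [::]; move: pq; rewrite prefixE.
  by rewrite take_oversize // cats0 => /eqP.
by exists p; apply: cswap_out; apply: long => //; rewrite sp ?leq_addr ?leq_addl.
Qed.

Lemma thompsonV_cswaps (H : set (homeo cantor_space)) :
  is_subgroup H -> (forall u v, H (cswap u v)) -> thompsonV `<=` H.
Proof.
by move=> sgH Hsw g /thompsonVP[D [h [bD gh]]]; exact: cswaps_generate bD gh.
Qed.

(** * Reduction of all swaps to swaps of short words *)

Section CswapSubgroup.
Variable H : set (homeo cantor_space).
Hypothesis sgH : is_subgroup H.

Lemma subgroup_cswapJ f u v u' v' :
  H f -> acts f u u' -> acts f v v' -> H (cswap u v) -> H (cswap u' v').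
Proof.
move=> Hf fu fv Huv; have [uv|uv] := boolP (incomparable u v).
  rewrite -(cswapJ uv fu fv); do 2!apply: subgroupM => //.
  exact: subgroupV.
rewrite cswap_id; first exact: subgroup1.
by apply: contra uv; apply: acts_incomparable (actsV fu) (actsV fv).
Qed.

Lemma subgroup_cswap_merge u v :
  H (cswap (rcons u false) (rcons v false)) ->
  H (cswap (rcons u true) (rcons v true)) -> H (cswap u v).
Proof.
move=> H0 H1; have [uv|uv] := boolP (incomparable u v).
 rewrite cswap_merge //; exact: (subgroupM sgH H0 H1).
by rewrite cswap_id //; exact: subgroup1.
Qed.

(** Conjugation by [cswap v w] fixes [u] and carries [v] to [w]. *)
Lemma subgroup_cswap_trans u v w :
  incomparable u v -> incomparable u w -> incomparable v w ->
  H (cswap u v) -> H (cswap v w) -> H (cswap u w).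
Proof.
move=> uv uw vw Huv Hvw; apply: (subgroup_cswapJ Hvw _ (cswapl vw) Huv).
by apply: cswap_out; rewrite incomparableC.
Qed.

(** There are four words of length 2, and at most two are excluded. *)
Lemma word2_avoid u v : exists q, [/\ size q = 2, q != take 2 u & q != take 2 v].
Proof.
have : has (fun q => (q != take 2 u) && (q != take 2 v)) (words 2).
  by case: (take 2 u) (take 2 v) => [|[] [|[] [|? ?]]] [|[] [|[] [|? ?]]].
by move=> /hasP[q]; rewrite mem_words => /eqP sq /andP[]; exists q.
Qed.

(* If [u] is long, conjugating by a swap of its prefix of length 3 with a word
   of length 2 shortens [u] and does not lengthen [v]. *)
Lemma subgroup_cswap_long :
  (forall p q, size q = 2 -> 2 <= size p <= 3 -> H (cswap p q)) ->
  forall u v, 2 <= size u -> 2 <= size v -> H (cswap u v).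
Proof.
move=> Hbase u v; have [n] := ubnP (size u + size v).
elim: n u v => // n IH u v.
wlog vu : u v / size v <= size u => [hw suv su sv|].
  case/orP: (leq_total (size v) (size u)) => le; first exact: hw.
  by rewrite cswapC; apply: hw; rewrite // addnC.
rewrite ltnS => suv su sv; have [uv|uv] := boolP (incomparable u v); last first.
  by rewrite cswap_id //; exact: subgroup1.
have [short|long] := boolP ((size v <= 2) && (size u <= 3)).
  have /andP[v2 u3] := short.
  by apply: Hbase; [apply/eqP; rewrite eqn_leq v2|rewrite su].
have u3 : 3 <= size u.
  rewrite ltnNge; apply: contra long => u2.
  by rewrite (leq_trans vu u2) (leq_trans u2).
have [q [sq qu qv]] := word2_avoid u v.
have same_size p r : size p = size r -> p != r -> incomparable p r.
  move=> pr; rewrite /incomparable !prefixE !take_oversize ?pr //.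
  by rewrite (eq_sym r) => ->.
have short_incomparable r : 2 <= size r -> q != take 2 r -> incomparable q r.
  move=> r2 qr; apply/andP; split; apply: contra qr => qr.
    by move: qr; rewrite prefixE sq eq_sym.
  have r2' : size r = 2 by apply/eqP; rewrite eqn_leq r2 -{1}sq size_prefix.
  move: qr; rewrite prefixE r2' take_oversize ?sq // => /eqP->.
  by rewrite take_oversize // r2'.
pose p := take 3 u; pose s := drop 3 u.
have sp : size p = 3 by rewrite size_takel.
have u_ps : u = p ++ s by rewrite cat_take_drop.
have qp : incomparable q p.
  by apply: short_incomparable; rewrite ?sp // take_takel.
have pq : incomparable p q by rewrite incomparableC.
have fu : acts (cswap p q) (q ++ s) u.
  by rewrite u_ps; apply: acts_cat; exact: cswapr.
have szu : size u = (size s).+3 by rewrite u_ps size_cat sp.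
have Hpq : H (cswap p q) by apply: Hbase; rewrite ?sp.
(* If [v] extends [p] too, the swap shortens both words; otherwise it fixes [v]. Since [q] has
   length 2, the shortened words still have length at least 2. *)
have [/prefixP[s' v_ps]|pv] := boolP (prefix p v).
  have fv : acts (cswap p q) (q ++ s') v.
    by rewrite v_ps; apply: acts_cat; exact: cswapr.
  apply: (subgroup_cswapJ Hpq fu fv); apply: IH; rewrite ?size_cat ?sq //.
  apply: leq_trans suv; rewrite szu v_ps size_cat sp !addSn !add0n ltnS.
  by rewrite !addnS !ltnS leqW // leqW.
have vp : incomparable p v.
  rewrite /incomparable pv; apply: contraL uv => vp.
  by rewrite /incomparable u_ps prefix_catl ?andbF.
have fv : acts (cswap p q) v v by apply: cswap_out => //; exact: short_incomparable.
apply: (subgroup_cswapJ Hpq fu fv); apply: IH; rewrite ?size_cat ?sq //.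
by apply: leq_trans suv; rewrite szu.
Qed.

(** Incomparable words are nonempty, so their children have length at least 2 and the swaps of the
    children merge. *)
Lemma subgroup_cswaps :
  (forall p q, size q = 2 -> 2 <= size p <= 3 -> H (cswap p q)) ->
  forall u v, H (cswap u v).
Proof.
move=> /subgroup_cswap_long Hl u v; have [uv|uv] := boolP (incomparable u v).
  move: uv => /andP[].
  case: u => [|b u]; first by rewrite prefix0s.
  case: v => [|c v]; first by rewrite prefix0s.
  by move=> _ _; apply: subgroup_cswap_merge; apply: Hl; rewrite !size_rcons.
by rewrite cswap_id //; exact: subgroup1.
Qed.

End CswapSubgroup.

(** * Deciding identities between products of swaps *)

Definition movable p q u :=
  incomparable p q &&
    [|| prefix p u, prefix q u | incomparable p u && incomparable q u].

Definition move p q u :=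
  if prefix p u then q ++ drop (size p) u
  else if prefix q u then p ++ drop (size q) u
  else u.

(** For incomparable [p] and [q], the words left out are the proper prefixes of [p] or [q]. *)
Lemma acts_move p q u : movable p q u -> acts (cswap p q) u (move p q u).
Proof.
rewrite /movable /move => /andP[pq]; case: ifP => [pu _|_ /=].
  exact: acts_prefix (cswapl pq) pu.
case: ifP => [qu _|_ /= /andP[pu qu]].
  exact: acts_prefix (cswapr pq) qu.
exact: cswap_out.
Qed.

(** Since the action is on the right, the head of the list is applied first. *)
Definition cswaps (L : seq (seq bool * seq bool)) : homeo cantor_space :=
  foldr (fun pq f => cswap pq.1 pq.2 * f) 1 L.

Lemma cswaps_cat L1 L2 : cswaps (L1 ++ L2) = cswaps L1 * cswaps L2.
Proof. by elim: L1 => [|pq L1 IH] /=; rewrite ?mul1g // IH mulgA. Qed.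

Lemma cswaps_rev L : cswaps (rev L) = (cswaps L)^-1.
Proof.
elim: L => [|pq L IH]; first by rewrite invg1.
by rewrite rev_cons -cats1 cswaps_cat IH /= mulg1 invgM cswapV.
Qed.

(* [None] when [u] is too short for a swap of [L] to replace a prefix of it. *)
Fixpoint track (L : seq (seq bool * seq bool)) u :=
  if L is (p, q) :: L' then
    if movable p q u then track L' (move p q u) else None
  else Some u.

Lemma acts_track L u v : track L u = Some v -> acts (cswaps L) u v.
Proof.
elim: L u => [|[p q] L IH] u /=; first by case=> ->; exact: acts1.
by case: ifP => // pqu /IH; apply: actsM; exact: acts_move.
Qed.

(** The cones of the words of length [n] cover the space, so an identity in V becomes a finite
    computation; [n] must be large enough for tracking to succeed. *)
Lemma cswaps_eq n L1 L2 :
  all (fun u => if track L1 u is Some v then track L2 u == Some v else false)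
    (words n) -> cswaps L1 = cswaps L2.
Proof.
move=> /allP eqL; apply: homeoP => x; have [u su [y _ <-]] := cone_take n x.
have := eqL u; rewrite mem_words su eqxx => /(_ isT).
by case E: (track L1 u) => [v|//] /eqP /acts_track ->; rewrite (acts_track E).
Qed.

Definition swap_in (K : seq (seq bool * seq bool)) u v :=
  ((u, v) \in K) || ((v, u) \in K).

(** Conjugation is read backwards, by testing the candidates in [C]; this restricts the lists to the
    pairs of interest. *)
Definition conjugates K1 K2 (C : seq (seq bool * seq bool)) :=
  [seq c <- C | has (fun pq =>
    [&& movable pq.1 pq.2 c.1, movable pq.1 pq.2 c.2
      & swap_in K2 (move pq.1 pq.2 c.1) (move pq.1 pq.2 c.2)]) K1].

Definition merges K (C : seq (seq bool * seq bool)) :=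
  [seq c <- C | swap_in K (rcons c.1 false) (rcons c.2 false) &&
                swap_in K (rcons c.1 true) (rcons c.2 true)].

Definition contains (H : set (homeo cantor_space)) (K : seq (seq bool * seq bool)) :=
  forall pq, pq \in K -> H (cswap pq.1 pq.2).

Section Contains.
Variable H : set (homeo cantor_space).
Hypothesis sgH : is_subgroup H.

Lemma contains_cat K1 K2 :
  contains H K1 -> contains H K2 -> contains H (K1 ++ K2).
Proof. by move=> H1 H2 pq; rewrite mem_cat => /orP[/H1|/H2]. Qed.

Lemma contains_swap_in K u v : contains H K -> swap_in K u v -> H (cswap u v).
Proof. by move=> HK /orP[/HK//|/HK]; rewrite cswapC. Qed.

Lemma contains_conjugates K1 K2 C :
  contains H K1 -> contains H K2 -> contains H (conjugates K1 K2 C).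
Proof.
move=> H1 H2 c; rewrite mem_filter => /andP[/hasP[pq /H1 Hpq]].
move=> /and3P[m1 m2 /(contains_swap_in H2) Hc] _.
(* A swap is its own inverse, so it carries the moved words back to the candidate. *)
by apply: (subgroup_cswapJ sgH Hpq) Hc; rewrite -(cswapV pq.1); apply: actsV;
  exact: acts_move.
Qed.

Lemma contains_merges K C : contains H K -> contains H (merges K C).
Proof.
move=> HK c; rewrite mem_filter => /andP[/andP[H0 H1] _].
by apply: subgroup_cswap_merge => //; exact: contains_swap_in HK _.
Qed.

End Contains.

(** * The ten leaves and the explicit identities *)

Section Leaves.

Local Notation o := false.
Local Notation i := true.

Definition leaves : seq (seq bool) :=
  [:: [:: o; o; o]; [:: o; i; o]; [:: i; i; i; i]; [:: o; o; i];
      [:: i; i; i; o]; [:: o; i; i; o]; [:: i; o; i]; [:: o; i; i; i];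
      [:: i; i; o]; [:: i; o; o]].

(** Indices are read modulo 10, so that sigma always carries [leaf n] to [leaf n.+1]. *)
Definition leaf n := nth [::] leaves (n %% 10).

(* The cycle (a_0 a_1 ... a_9) is the product (a_0 a_1)(a_0 a_2)...(a_0 a_9). *)
Definition leaf_cycle := [seq (leaf 0, leaf n) | n <- iota 1 9].

Definition swap0 := [:: ([:: o; o], [:: o; i])].

Definition swap1 := [:: ([:: i; o], [:: i; i])].

Definition swap_011 := [:: ([:: o; o; i], [:: o; i; i])].

Definition flip := [:: ([:: o], [:: i])].

Definition three_cycle := [:: (leaf 0, leaf 1); (leaf 0, leaf 2)].

(* With t = (00 01) and sigma the cycle, t is the product of (a_0 a_1) and of
   (001 011), and t and its conjugate by sigma have the product of the 3-cycle
   and of two commuting swaps, which squaring removes. *)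
Definition two_conjugates := swap0 ++ rev leaf_cycle ++ swap0 ++ leaf_cycle.

Lemma three_cycleE :
  cswaps three_cycle = cswaps (two_conjugates ++ two_conjugates).
Proof. by apply: (@cswaps_eq 6); vm_compute. Qed.

(** For the 3-cycle c this is c^-1 sigma^-2. Its fourth power times sigma^8 telescopes to a product
    of conjugates of c^-1. *)
Definition shifted_three_cycle :=
  rev three_cycle ++ rev leaf_cycle ++ rev leaf_cycle.

Definition pow4 (L : seq (seq bool * seq bool)) := L ++ L ++ L ++ L.

(* The conjugates of the inverse 3-cycle by sigma^0, sigma^2, sigma^4 and
   sigma^6 multiply to the inverse of (a_0 a_1 ... a_8); the right-hand side is
   sigma times this product, with adjacent powers of sigma collected. *)
Lemma adjacent_swapE :
  cswaps [:: (leaf 8, leaf 9)] =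
  cswaps (leaf_cycle ++ pow4 shifted_three_cycle ++ pow4 (leaf_cycle ++ leaf_cycle)).
Proof. by apply: (@cswaps_eq 4); vm_compute. Qed.

Lemma swap0_split :
  cswaps swap_011 = cswaps (swap0 ++ [:: (leaf 0, leaf 1)]).
Proof. by apply: (@cswaps_eq 4); vm_compute. Qed.

Lemma flip_leaf_cycle : cswaps (flip ++ leaf_cycle ++ flip) = cswaps (rev leaf_cycle).
Proof. by apply: (@cswaps_eq 5); vm_compute. Qed.

Lemma flip_swap0 : cswaps (flip ++ swap0 ++ flip) = cswaps swap1.
Proof. by apply: (@cswaps_eq 3); vm_compute. Qed.

Lemma acts_leaf_cycle n : acts (cswaps leaf_cycle) (leaf n) (leaf n.+1).
Proof.
have h j : j < 10 -> acts (cswaps leaf_cycle) (leaf j) (leaf j.+1).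
  by do 10![case: j => [_|j]; first by apply: acts_track; vm_compute].
rewrite /leaf -(modn_mod n) -[n.+1]addn1 -modnDml addn1.
exact/h/ltn_pmod.
Qed.

Lemma leaf_add10 n : leaf (10 + n) = leaf n.
Proof. by rewrite /leaf modnDl. Qed.

Lemma leaf_mem n : leaf n \in leaves.
Proof. by apply: mem_nth; exact: ltn_pmod. Qed.

Lemma leavesP u : u \in leaves -> exists2 n, n < 10 & u = leaf n.
Proof.
move=> /(nthP [::])[n n10 <-]; exists n => //.
by rewrite /leaf modn_small.
Qed.

Lemma leaves_incomparable : {in leaves &, forall u v, u != v -> incomparable u v}.
Proof.
have /allP h : all (fun u =>
    all (fun v => (u != v) ==> incomparable u v) leaves) leaves.
  by vm_compute.
by move=> u v /h/allP huv /huv/implyP.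
Qed.

Definition leaf_pairs := [seq (u, v) | u <- leaves, v <- leaves].

(** Conjugating (001 011) by swaps of leaves outside the cone of 011 replaces 001 by the other
    leaves outside that cone. *)
Definition pairs_011 :=
  conjugates leaf_pairs swap_011 [seq (u, [:: o; i; i]) | u <- leaves].

(** A swap of 011 with a leaf of length 3 carries the leaves 0110 and 0111 to the children of that
    leaf. *)
Definition pairs_4 :=
  conjugates pairs_011 leaf_pairs [seq (u, v) | u <- words 4, v <- leaves].

(** The word 111 is not a leaf, but its children 1110 and 1111 are. *)
Definition pairs_111 :=
  merges (leaf_pairs ++ pairs_4) [seq (u, [:: i; i; i]) | u <- words 3].

Definition pairs_22 :=
  merges (leaf_pairs ++ pairs_011 ++ pairs_111)
    [seq (u, v) | u <- words 2, v <- words 2].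

Definition pairs_00 :=
  merges (leaf_pairs ++ pairs_4) [seq ([:: o; o], [:: o; i; b]) | b <- [:: o; i]].

Definition conj_22 K :=
  K ++ conjugates pairs_22 K [seq (u, v) | u <- words 3, v <- words 2].

(** Two rounds suffice: at most two transpositions of the words of length 2 carry 00 and 01 to any
    two distinct ones. *)
Definition pairs_23 := conj_22 (conj_22 pairs_00).

Lemma pairs_complete p q : size q = 2 -> 2 <= size p <= 3 -> incomparable p q ->
  swap_in (pairs_22 ++ pairs_23) p q.
Proof.
move=> q2 p23 pq; have /allP/(_ p) : all (fun p => all (fun q => incomparable p q ==>
    swap_in (pairs_22 ++ pairs_23) p q) (words 2)) (words 2 ++ words 3).
  by vm_compute.
rewrite mem_cat !mem_words; have -> : (size p == 2) || (size p == 3).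
  by case: (size p) p23 => [|[|[|[|]]]].
by move=> /(_ isT)/allP/(_ q); rewrite mem_words q2 pq; exact.
Qed.

End Leaves.

(** * Subgroups containing (00 01) and sigma *)

Section Generation.
Variable H : set (homeo cantor_space).
Hypotheses (sgH : is_subgroup H) (Hswap0 : H (cswaps swap0)).
Hypothesis Hcycle : H (cswaps leaf_cycle).

Lemma subgroup_cswaps_cat L1 L2 :
  H (cswaps L1) -> H (cswaps L2) -> H (cswaps (L1 ++ L2)).
Proof. by rewrite cswaps_cat; exact: subgroupM. Qed.

Lemma subgroup_cswaps_rev L : H (cswaps L) -> H (cswaps (rev L)).
Proof. by rewrite cswaps_rev; exact: subgroupV. Qed.

Lemma subgroup_three_cycle : H (cswaps three_cycle).
Proof.
rewrite three_cycleE.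
suff Hc : H (cswaps two_conjugates) by exact: subgroup_cswaps_cat.
exact: (subgroup_cswaps_cat Hswap0 (subgroup_cswaps_cat
  (subgroup_cswaps_rev Hcycle) (subgroup_cswaps_cat Hswap0 Hcycle))).
Qed.

Lemma subgroup_adjacent_swap : H (cswaps [:: (leaf 8, leaf 9)]).
Proof.
have Hr := subgroup_cswaps_rev Hcycle.
have Hc : H (cswaps shifted_three_cycle).
  exact: (subgroup_cswaps_cat (subgroup_cswaps_rev subgroup_three_cycle)
    (subgroup_cswaps_cat Hr Hr)).
have H4 L : H (cswaps L) -> H (cswaps (pow4 L)).
  by move=> HL; exact: (subgroup_cswaps_cat HL (subgroup_cswaps_cat HL
    (subgroup_cswaps_cat HL HL))).
have Hd := H4 _ (subgroup_cswaps_cat Hcycle Hcycle).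
rewrite adjacent_swapE.
exact: (subgroup_cswaps_cat Hcycle (subgroup_cswaps_cat (H4 _ Hc) Hd)).
Qed.

Lemma subgroup_leaf_swap_succ n : H (cswap (leaf n) (leaf n.+1)).
Proof.
(* Conjugation by sigma climbs from (a_8 a_9); index [n] is reached as [n + 2 + 8], modulo 10. *)
suff Hn m : H (cswap (leaf (m + 8)) (leaf (m + 8).+1)).
  have := Hn (n + 2); rewrite -addnA -addnS [_ + 10]addnC leaf_add10.
  by rewrite [(n + _)%N]addnS [(_ + 10)%N]addnC -addnS leaf_add10.
elim: m => [|m IH].
  by have := subgroup_adjacent_swap; rewrite /cswaps [foldr _ _ _]mulg1.
by apply: (subgroup_cswapJ sgH Hcycle) IH; exact: acts_leaf_cycle.
Qed.

Lemma subgroup_leaf_pairs : contains H leaf_pairs.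
Proof.
have Hn n m : H (cswap (leaf n) (leaf (n + m))).
  elim: m => [|m IH].
    by rewrite addn0 cswap_id ?incomparablexx //; exact: subgroup1.
  have Hs := subgroup_leaf_swap_succ (n + m); rewrite addnS.
  have [->|uw] := eqVneq (leaf n) (leaf (n + m).+1).
    by rewrite cswap_id ?incomparablexx //; exact: subgroup1.
  have [->//|uv] := eqVneq (leaf n) (leaf (n + m)).
  have [<-//|vw] := eqVneq (leaf (n + m)) (leaf (n + m).+1).
  by apply: (subgroup_cswap_trans sgH _ _ _ IH Hs); apply: leaves_incomparable;
    rewrite ?leaf_mem.
move=> _ /allpairsP[[u v] [/leavesP[n n10 ->] /leavesP[m _ ->] ->]] /=.
(* Replacing [m] by [10 + m] puts the second index above the first. *)
by rewrite -(leaf_add10 m) -(subnKC (ltnW n10)) -addnA; exact: Hn.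
Qed.

Lemma subgroup_all_cswaps u v : H (cswap u v).
Proof.
have HA := subgroup_leaf_pairs.
have Hsplit : contains H swap_011.
  move=> pq; rewrite inE => /eqP-> /=.
  have := swap0_split; rewrite cswaps_cat /= !mulg1 => ->.
  apply: subgroupM => //; first by move: Hswap0; rewrite /= mulg1.
  exact: subgroup_leaf_swap_succ 0.
have HB : contains H pairs_011 by exact: contains_conjugates.
have HC : contains H pairs_4 by exact: contains_conjugates.
have HAC := contains_cat HA HC.
have HD : contains H pairs_111 by exact: contains_merges.
have HE : contains H pairs_22.
  exact: (contains_merges sgH (contains_cat HA (contains_cat HB HD))).
have Hconj K : contains H K -> contains H (conj_22 K).
  by move=> HK; exact: (contains_cat HK (contains_conjugates sgH HE HK)).
have HF : contains H pairs_23.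
  exact: (Hconj _ (Hconj _ (contains_merges sgH HAC))).
apply: subgroup_cswaps => // p q q2 p23.
have [pq|pq] := boolP (incomparable p q); last first.
  by rewrite cswap_id //; exact: subgroup1.
exact: (contains_swap_in (contains_cat HE HF) (pairs_complete q2 p23 pq)).
Qed.

End Generation.

Lemma thompsonV_generated (H : set (homeo cantor_space)) : is_subgroup H ->
  H (cswaps swap0) -> H (cswaps leaf_cycle) -> thompsonV `<=` H.
Proof.
move=> sgH H0 Hc; apply: thompsonV_cswaps => // u v.
exact: subgroup_all_cswaps.
Qed.

(** * The two generating pairs *)

Lemma subgroup_gen_subgroup (G : groupType) (A : set G) :
  is_subgroup (subgroup_gen A).
Proof.
split=> [|a b /set_mem Ha /set_mem Hb]; apply/mem_set => M [sgM AM].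
  exact: subgroup1.
by apply: subgroupM; [|exact: Ha|apply: subgroupV => //; exact: Hb].
Qed.

Lemma subgroup_conj (G : groupType) (H : set G) a :
  is_subgroup H -> is_subgroup [set b : G | H (b ^ a)].
Proof.
move=> sgH; split=> [|b c /set_mem Hb /set_mem Hc]; apply/mem_set => /=.
  by rewrite conj1g; exact: subgroup1.
by rewrite conjMg conjVg; apply: subgroupM => //; exact: subgroupV.
Qed.

Lemma thompsonV_cswaps_mem L : thompsonV (cswaps L).
Proof.
elim: L => [|pq L IH]; first exact: subgroup1 thompsonV_subgroup.
exact: (subgroupM thompsonV_subgroup (thompsonV_cswap _ _) IH).
Qed.

Lemma swap_cswaps u v uv : swap u v uv = cswaps [:: (u, v)].
Proof. by rewrite -cswapE /cswaps [RHS]mulg1. Qed.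

(** The other inclusion is automatic, since products of swaps lie in V. *)
Lemma thompsonV_gen_pair L1 L2 :
  thompsonV `<=` subgroup_gen [set cswaps L1; cswaps L2] ->
  subgroup_gen [set cswaps L1; cswaps L2] = thompsonV.
Proof.
move=> VG; apply/seteqP; split=> //; apply: smallest_sub.
  exact: thompsonV_subgroup.
by move=> _ [] -> /=; exact: thompsonV_cswaps_mem.
Qed.

Theorem theorem14 :
  exists sigma : homeo cantor_space,
    [/\ thompsonV sigma,
        subgroup_gen
          [set swap [:: false; false] [:: false; true] disjoint_00_01; sigma]
          = thompsonV
      & subgroup_gen
          [set swap [:: true; false] [:: true; true] disjoint_10_11; sigma]
          = thompsonV].
Proof.
exists (cswaps leaf_cycle); split; first exact: thompsonV_cswaps_mem.
  rewrite swap_cswaps -/swap0.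
  apply: thompsonV_gen_pair.
  by apply: (thompsonV_generated (subgroup_gen_subgroup _));
    apply: sub_gen_smallest; [left|right].
rewrite swap_cswaps -/swap1.
apply: thompsonV_gen_pair => gamma Vgamma.
set H := subgroup_gen _; have sgH : is_subgroup H by exact: subgroup_gen_subgroup.
have flipV : (cswaps flip)^-1 = cswaps flip by rewrite -cswaps_rev.
have flipJ L : cswaps L ^ cswaps flip = cswaps (flip ++ L ++ flip).
  by rewrite conjgE flipV !cswaps_cat.
(* This subgroup contains (00 01), whose conjugate by the flip is (10 11), and sigma, whose
   conjugate is sigma^-1; so it contains V. As the flip is an involution, conjugating twice gives
   back [gamma]. *)
have : [set g | H (g ^ cswaps flip)] (gamma ^ cswaps flip).
  apply: thompsonV_generated.
  - exact: subgroup_conj.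
  - by rewrite /mkset flipJ flip_swap0; apply: sub_gen_smallest; left.
  - rewrite /mkset flipJ flip_leaf_cycle cswaps_rev; apply: (subgroupV sgH).
    by apply: sub_gen_smallest; right.
  - have sgV := thompsonV_subgroup; have Vflip := thompsonV_cswaps_mem flip.
    by rewrite conjgE; exact: (subgroupM sgV (subgroupV sgV Vflip)
      (subgroupM sgV Vgamma Vflip)).
by rewrite /mkset -{2}flipV conjgK.
Qed.
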